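(* Let $m$ and $s$ be positive integers, and let the numbers $a(\cdot,\cdot)$, indexed by pairs of non-negative integers, be defined recursively by $a(m,0)=a(0,s)=1$ for all non-negative integers $m,s$ and $a(m,s)=a(m-1,s)+a(m,s-1)+a(m-1,s-1)$ for all positive integers $m,s$. Then: 1. $$a(m,s)=\sum_{k=0}^s \binom{s}{k}\binom{m}{k}2^k.$$ 2. If $G$ is a finite abelian group of order $n$ that contains an $s$-spanning set of size $m$, then $n\le a(m,s)$.
   Context: Let $G$ be a finite abelian group written additively, $s$ a non-negative integer, and $A=\{a_1,\dots,a_m\}$ a subset of $G$ of size $m$. $A$ is an $s$-spanning set in $G$ if every $g\in G$ can be written as $g=\lambda_1a_1+\lambda_2a_2+\cdots+\lambda_m a_m$ for some integers $\lambda_1,\dots,\lambda_m$ with $|\lambda_1|+|\lambda_2|+\cdots+|\lambda_m|\le s$. *)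

(* Defs.v *)
From mathcomp Require Import all_boot all_order all_algebra.

Set Implicit Arguments.
Unset Strict Implicit.
Unset Printing Implicit Defensive.

Import GRing.Theory.

(* The nested recursion is needed because the second argument also decreases
   while the first stays fixed; the four lemmas below are the recursive
   definition as usually written. *)
Fixpoint delannoy (m : nat) : nat -> nat :=
  match m with
  | 0 => fun _ => 1
  | m'.+1 => fix delannoy_m (s : nat) : nat :=
      match s with
      | 0 => 1
      | s'.+1 => delannoy m' s'.+1 + delannoy_m s' + delannoy m' s'
      end
  end.

Lemma delannoy0n (s : nat) : delannoy 0 s = 1.
Proof. by []. Qed.

Lemma delannoyn0 (m : nat) : delannoy m 0 = 1.
Proof. by case: m. Qed.

Lemma delannoySS (m s : nat) :
  delannoy m.+1 s.+1 = delannoy m s.+1 + delannoy m.+1 s + delannoy m s.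
Proof. by []. Qed.

Lemma delannoy_rec (m s : nat) : 0 < m -> 0 < s ->
  delannoy m s = delannoy (m - 1) s + delannoy m (s - 1)
                 + delannoy (m - 1) (s - 1).
Proof. by case: m s => [|m] [|s] // _ _; rewrite !subn1 -delannoySS. Qed.

(* The coefficient function is total on G, but only its values on A are used. *)
Definition spanning_set (G : finZmodType) (s : nat) (A : {set G}) : Prop :=
  forall g : G, exists lambda : G -> int,
    (\sum_(a in A) `|lambda a|%N <= s)%N
    /\ g = (\sum_(a in A) a *~ lambda a)%R.

(* Main.v *)
(** Part 2 counts the pairs (coefficient of [a], element spanned by the
    remaining generators): splitting a coefficient by its sign and peeling off
    one copy of [a] or [-a] at a time shows that [delannoy m s] elements suffice
    to list everything spanned with weight at most [s], since
    a(m+1,s) = a(m,s) + 2 (a(m,0) + ... + a(m,s-1)). *)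
Require Import Defs.
From mathcomp Require Import all_boot all_order all_algebra.
From mathcomp Require Import zify.

Set Implicit Arguments.
Unset Strict Implicit.
Unset Printing Implicit Defensive.

Import GRing.Theory.

(** The cutoff [N] is kept apart from [s] so that all sums in the recurrence share one range; terms
    with [k > s] vanish. *)
Definition delannoy_sum (N m s : nat) : nat :=
  \sum_(k < N) 'C(s, k) * 'C(m, k) * 2 ^ k.

Lemma delannoy_sum_recl (N m s : nat) :
  delannoy_sum N.+1 m s
  = 1 + \sum_(k < N) 'C(s, k.+1) * 'C(m, k.+1) * 2 ^ k.+1.
Proof. by rewrite /delannoy_sum big_ord_recl !bin0. Qed.

Lemma delannoy_sum_widen (N m s : nat) :
  s < N -> delannoy_sum N.+1 m s = delannoy_sum N m s.
Proof.
by move=> ltsN; rewrite /delannoy_sum big_ord_recr /= bin_small ?addn0.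
Qed.

Lemma delannoy_sumSS (N m s : nat) : s < N ->
  delannoy_sum N.+1 m.+1 s.+1
  = delannoy_sum N.+1 m s.+1 + delannoy_sum N.+1 m.+1 s + delannoy_sum N.+1 m s.
Proof.
move=> ltsN; have := delannoy_sum_widen m ltsN.
rewrite !delannoy_sum_recl => sum_ms.
set AB := \sum_(k < N) _ in sum_ms *.
(* Termwise, Pascal's rule in both binomials leaves an excess of
   [2 * ('C(s, k) * 'C(m, k) * 2 ^ k)]. By [sum_ms] its sum is [2 * (1 + AB)], and one [AB]
   cancels. *)
have : \sum_(k < N) 'C(s.+1, k.+1) * 'C(m.+1, k.+1) * 2 ^ k.+1 + AB
  = \sum_(k < N) 'C(s.+1, k.+1) * 'C(m, k.+1) * 2 ^ k.+1
    + \sum_(k < N) 'C(s, k.+1) * 'C(m.+1, k.+1) * 2 ^ k.+1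
    + 2 * delannoy_sum N m s.
  rewrite /delannoy_sum big_distrr -!big_split /=.
  by apply: eq_bigr => k _; rewrite !binS expnS; nia.
lia.
Qed.

Lemma delannoy_closed (N m s : nat) :
  s < N -> delannoy m s = delannoy_sum N m s.
Proof.
case: N => // N; elim: m s => [|m IHm] s.
  move=> _; rewrite delannoy0n delannoy_sum_recl big1 // => k _.
  by rewrite bin0n muln0.
elim: s => [|s IHs] ltsN.
  by rewrite delannoyn0 delannoy_sum_recl big1.
by rewrite delannoySS delannoy_sumSS ?IHm ?IHs // ltnW.
Qed.

(** Unrolls the recurrence in [s]. The two sums match the non-negative and the negative coefficients
    of one new generator. *)
Lemma delannoySn (m s : nat) :
  delannoy m.+1 s = \sum_(j < s.+1) delannoy m j + \sum_(j < s) delannoy m j.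
Proof.
elim: s => [|s IHs]; first by rewrite big_ord1 big_ord0 !delannoyn0.
rewrite delannoySS IHs [in RHS]big_ord_recr [in X in _ = _ + X]big_ord_recr /=.
lia.
Qed.

Section Reach.

Variable G : zmodType.
Implicit Types (a x : G) (f : nat -> seq G) (l : seq G).

(** Concatenates the translates of [f (s - k)] by [a *+ k] for [k] from 0 to [s]: [k] copies of [a]
    use up [k] of the weight. *)
Fixpoint ray f a (s : nat) : seq G :=
  f s ++ (if s is s'.+1 then map (+%R a) (ray f a s') else [::]).

(** The negative ray starts at [- a] with weight [s - 1], so coefficient 0 is listed only once and
    the length is exactly a Delannoy number. *)
Fixpoint reach l (s : nat) : seq G :=
  if l is a :: l' then
    ray (reach l') a s
    ++ (if s is s'.+1 then map (+%R (- a)%R) (ray (reach l') (- a)%R s')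
        else [::])
  else [:: 0%R].

Lemma size_ray f a s : size (ray f a s) = \sum_(j < s.+1) size (f j).
Proof.
elim: s => [|s IHs]; first by rewrite /= cats0 big_ord1.
by rewrite big_ord_recr /= size_cat size_map IHs addnC.
Qed.

Lemma size_reach l s : size (reach l s) = delannoy (size l) s.
Proof.
elim: l s => // a l IHl s.
have size_rayE b t : size (ray (reach l) b t) = \sum_(j < t.+1) delannoy (size l) j.
  by rewrite size_ray; apply: eq_bigr => j _; apply: IHl.
rewrite [size (a :: l)]/= delannoySn [reach _ _]/= size_cat size_rayE.
by case: s => [|s]; rewrite ?big_ord0 // size_map size_rayE.
Qed.

Lemma mem_ray f a x s k :
  k <= s -> x \in f (s - k) -> (a *+ k + x)%R \in ray f a s.
Proof.
elim: k s => [|k IHk] [|s] //= leks; rewrite ?mulr0n ?add0r ?subn0 ?mem_cat.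
- by move=> ->.
- by move=> ->.
rewrite subSS mulrS -addrA => xf.
by rewrite map_f ?orbT // IHk.
Qed.

Lemma mem_reach l (lambda : G -> int) s :
  \sum_(a <- l) `|lambda a|%N <= s ->
  (\sum_(a <- l) a *~ lambda a)%R \in reach l s.
Proof.
elim: l s => [|a l IHl] s; first by rewrite !big_nil inE.
rewrite !big_cons [reach _ _]/= mem_cat => le_s.
case: (lambda a) le_s => k /= le_s.
  by rewrite -pmulrn mem_ray ?IHl //; lia.
case: s le_s => [|s] le_s; first by lia.
(* [Negz k] means [-(k + 1)]: the outer translation supplies one [- a], the ray the other [k]. *)
rewrite NegzE mulrNz -mulNrz -pmulrn mulrS -addrA map_f ?orbT //.
by rewrite mem_ray ?IHl //; lia.
Qed.

End Reach.

(** The duplicate-free enumeration of [G] is contained in [reach (enum A) s], hence is no longer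
    than it. *)
Lemma card_spanning_set (G : finZmodType) (s : nat) (A : {set G}) :
  spanning_set s A -> #|G| <= delannoy #|A| s.
Proof.
move=> spanA; rewrite (cardE A) (cardE G) -size_reach.
apply: uniq_leq_size; first exact: enum_uniq.
move=> g _; have [lambda [le_s ->]] := spanA g.
by rewrite -big_enum mem_reach // big_enum.
Qed.

Theorem theorem2 (m s : nat) (hm : 0 < m) (hs : 0 < s) :
  delannoy m s = \sum_(0 <= k < s.+1) 'C(s, k) * 'C(m, k) * 2 ^ k
  /\ (forall (G : finZmodType) (n : nat), #|G| = n ->
        (exists A : {set G}, #|A| = m /\ spanning_set s A) ->
        n <= delannoy m s).
Proof.
split; first by rewrite big_mkord; apply: delannoy_closed.
by move=> G _ <- [A [<- spanA]]; apply: card_spanning_set.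
Qed.
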